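(* Let $X_1,\ldots,X_n$ be independent, identically distributed real random variables with mean $\mu$ and (finite) variance $\sigma^2$. Let $m,k$ be positive integers and assume that $n=mk$. Then the median-of-means estimator $\widehat{\mu}_n$ with $k$ blocks satisfies \[ \mathbb{P}\left\{ \left|\widehat{\mu}_n-\mu\right| > \sigma\sqrt{4/m}\right\} \le e^{-k/8}. \] In particular, for any $\delta\in(0,1)$, if $k=\lceil 8\log(1/\delta)\rceil$, then, with probability at least $1-\delta$, \[ \left|\widehat{\mu}_n-\mu\right| \le \sigma\sqrt{\frac{32\log(1/\delta)}{n}}. \]
   Context: Median: for real numbers $x_1,\ldots,x_k$, the median is $M(x_1,\ldots,x_k)=x_i$, where $i\in\{1,\ldots,k\}$ is such that \[ |\{j\in\{1,\ldots,k\}: x_j\le x_i\}|\ge \frac{k}{2}\quad\text{and}\quad |\{j\in\{1,\ldots,k\}: x_j\ge x_i\}|\ge \frac{k}{2}; \] if several indices $i$ fit this description, the smallest one is taken. Median-of-means estimator with $k$ blocks (when $n=mk$): fix a partition of $\{1,\ldots,n\}$ into $k$ blocks $B_1,\ldots,B_k$, each of size $m$. Define $Z_j=\frac{1}{m}\sum_{i\in B_j}X_i$ for $j=1,\ldots,k$ and $\widehat{\mu}_n=M(Z_1,\ldots,Z_k)$. $\log$ denotes the natural logarithm.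
   Formalization: The ''in particular'' bound is proved only if k>1 or 32δ log(1/δ)≥1, which excludes only k=1 with δ above about 0.968; there it is false as stated, e.g. δ=0.99, n=m=k=1, X=±1 with probability 1/2 each. *)

(* Defs.v *)
(* MathComp-Analysis. *)
From mathcomp Require Import all_boot all_order all_algebra.
From mathcomp Require Import all_classical all_reals all_analysis.

Set Implicit Arguments.
Unset Strict Implicit.
Unset Printing Implicit Defensive.

Import Order.TTheory GRing.Theory Num.Theory.
Local Open Scope classical_set_scope.
Local Open Scope ring_scope.

(* The product rule is required over every subfamily J, which is the usual
   definition of mutual independence for a finite family. *)
Definition mutually_independent (R : realType) (d : measure_display)
    (T : measurableType d) (P : probability T R) (n : nat)
    (X : 'I_n -> {RV P >-> R}) : Prop :=
  forall (J : {set 'I_n}) (A : 'I_n -> set R),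
    (forall i, measurable (A i)) ->
    P (\bigcap_(i in [set i | i \in J]) (X i @^-1` A i)) =
    (\prod_(i in J) P (X i @^-1` A i))%E.

(* Equality is only asked on measurable sets: elsewhere the value of a measure
   carries no meaning. *)
Definition identically_distributed (R : realType) (d : measure_display)
    (T : measurableType d) (P : probability T R) (n : nat)
    (X : 'I_n -> {RV P >-> R}) : Prop :=
  forall (i j : 'I_n) (A : set R), measurable A ->
    distribution P (X i) A = distribution P (X j) A.

Definition is_median_index (R : realType) (k : nat) (x : 'I_k -> R)
    (i : 'I_k) : bool :=
  (k%:R / 2 <= #|[set j | x j <= x i]%SET|%:R :> R) &&
  (k%:R / 2 <= #|[set j | x i <= x j]%SET|%:R :> R).

(* At most one i passes the test below, namely the smallest median index; it
   exists as soon as k > 0, so that the value 0 is only taken when k = 0. *)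
Definition median (R : realType) (k : nat) (x : 'I_k -> R) : R :=
  if [pick i | is_median_index x i &&
               [forall j, is_median_index x j ==> (i <= j)%N]]
  is Some i then x i else 0.

Definition blocks (n m k : nat) (B : 'I_k -> {set 'I_n}) : Prop :=
  [/\ forall j, #|B j| = m,
      forall j l, j != l -> (B j :&: B l)%SET = finset.set0
    & forall i, exists j, i \in B j].

Definition block_mean (R : realType) (T : Type) (n m k : nat)
    (B : 'I_k -> {set 'I_n}) (X : 'I_n -> T -> R) (j : 'I_k) (w : T) : R :=
  m%:R^-1 * \sum_(i in B j) X i w.

Definition median_of_means (R : realType) (T : Type) (n m k : nat)
    (B : 'I_k -> {set 'I_n}) (X : 'I_n -> T -> R) (w : T) : R :=
  median (fun j => block_mean m B X j w).

(* Main.v *)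
Require Import Defs.
From mathcomp Require Import all_boot all_order all_algebra.
From mathcomp Require Import all_classical all_reals all_analysis.
From mathcomp Require Import measurable_realfun ring lra zify.

Set Implicit Arguments.
Unset Strict Implicit.
Unset Printing Implicit Defensive.

Import Order.TTheory GRing.Theory Num.Theory.
Local Open Scope classical_set_scope.
Local Open Scope ring_scope.

(* If the median of the block means deviates from mu by more than t, then so do
   at least half of the block means. Each does so with probability at most
   p = sigma^2 / (m t^2) by Chebyshev, and these events are independent, so the
   deviation probability is at most P(Bin(k, p) >= k / 2).
   For t = sigma sqrt(4/m) we have p = 1/4 and the Chernoff bound with base 3
   gives (sqrt 3 / 2)^k <= exp(-k/8).
   In the second claim k is only an upper bound of 8 log(1/delta), so p may
   exceed 1/4, but p <= k / (4 (k - 1)) when k > 1. For odd k the Chernoff bound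
   then has a factor 1 / sqrt 3 to spare; for even k it is not sharp enough for
   small k and is replaced by a comparison of the binomial tail with a geometric
   series starting at the central term. For k = 1 the bound is p <= delta. *)

(** * Binomial tails *)

(** P(Bin(n, p) >= h), by conditioning on the first trial; the induction over blocks in
    [probability_count_le] has the same shape. *)
Fixpoint binomial_tail (R : nzRingType) (p : R) (n h : nat) : R :=
  match h, n with
  | 0, _ => 1
  | _.+1, 0 => 0
  | h'.+1, n'.+1 =>
      p * binomial_tail p n' h' + (1 - p) * binomial_tail p n' h
  end.

Section tail.
Context (R : realFieldType).
Implicit Types p : R.

Lemma binomial_tail0 p n : binomial_tail p n 0 = 1.
Proof. by case: n. Qed.

Lemma binomial_tail_gt p n h : (n < h)%N -> binomial_tail p n h = 0.
Proof.
elim: n h => [|n IH] [|h]//= nh.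
by rewrite !IH ?mulr0 ?addr0//; lia.
Qed.

(** Markov's inequality for 3^S with S distributed as Bin(n, p), whose expectation is (1 + 2 p)^n.
    Base 3 is optimal for p = 1/4 and h = n / 2. *)
Lemma binomial_tail_chernoff p n h : 0 <= p <= 1 ->
  binomial_tail p n h <= (1 + 2 * p) ^+ n / 3 ^+ h.
Proof.
move=> /andP[p0 p1].
have pp : 0 <= 1 + 2 * p by lra.
elim: n h => [|n IH] [|h] /=.
- by rewrite !expr0 divr1.
- by rewrite divr_ge0 ?exprn_ge0.
- by rewrite expr0 divr1 exprn_ege1//; lra.
have h1 := ler_wpM2l p0 (IH h).
have q0 : 0 <= 1 - p by lra.
have h2 := ler_wpM2l q0 (IH h.+1).
apply: (le_trans (lerD h1 h2)).
have e3 : 3 ^+ h != 0 :> R by rewrite expf_neq0.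
rewrite le_eqVlt; apply/orP; left; apply/eqP.
by rewrite !exprS; field; rewrite e3.
Qed.

(** Peels off the weight P(Bin(n, p) = h); Pascal's rule drives the induction. *)
Lemma binomial_tail_step p n h : binomial_tail p n h =
  binomial_tail p n h.+1 + 'C(n, h)%:R * p ^+ h * (1 - p) ^+ (n - h).
Proof.
elim: n h => [|n IH] [|h].
- by rewrite /= bin0 !expr0; ring.
- by rewrite /= bin0n !mul0r addr0.
- rewrite /= binomial_tail0.
  have -> : binomial_tail p n 1 = 1 - (1 - p) ^+ n.
    by have := IH 0%N; rewrite binomial_tail0 bin0 subn0 expr0; lra.
  by rewrite bin0 subn0 expr0 exprS; ring.
have -> : binomial_tail p n.+1 h.+1 =
  p * binomial_tail p n h + (1 - p) * binomial_tail p n h.+1 by [].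
have -> : binomial_tail p n.+1 h.+2 =
  p * binomial_tail p n h.+1 + (1 - p) * binomial_tail p n h.+2 by [].
rewrite [in LHS](IH h) [X in _ + (1 - p) * X](IH h.+1) binS natrD subSS.
have [hn|nh] := ltnP h n.
  by rewrite -(subnSK hn) !exprS; ring.
by rewrite (@bin_small n h.+1)// !exprS; ring.
Qed.

(* Beyond the middle, consecutive binomial weights decrease at least by the
   factor p / (1 - p): the tail is dominated by a geometric series. *)
Lemma binomial_tail_geometric p n h : 0 <= p <= 2^-1 -> (n <= h.*2)%N ->
  (1 - 2 * p) * binomial_tail p n h <=
    'C(n, h)%:R * p ^+ h * (1 - p) ^+ (n - h).+1.
Proof.
move=> /andP[p0 p2] nh.
have q0 : 0 <= 1 - p by lra.
have [d hd] : {d | (d = n.+1 - h)%N} by exists (n.+1 - h)%N.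
(* Downward induction on [h], starting beyond [n], where the tail vanishes. *)
elim: d h hd nh => [|d IH] h hd nh.
  rewrite binomial_tail_gt ?mulr0; last lia.
  by rewrite !mulr_ge0// ?exprn_ge0.
have hn : (h <= n)%N by lia.
rewrite binomial_tail_step mulrDr.
have step : 'C(n, h.+1)%:R * p ^+ h.+1 * (1 - p) ^+ (n - h.+1).+1 <=
    p * ('C(n, h)%:R * p ^+ h * (1 - p) ^+ (n - h)).
  have [ltn|] := ltnP h n; last first.
    by move=> nh'; rewrite bin_small// !mul0r !mulr_ge0 ?exprn_ge0.
  rewrite subnSK// exprS !mulrA ler_wpM2r ?exprn_ge0// [p * _]mulrC.
  rewrite ler_wpM2r ?exprn_ge0// ler_wpM2r//.
  rewrite ler_nat -(leq_pmul2l (ltn0Sn h)) mul_bin_left leq_mul2r; lia.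
(* With w the weight at [h]: p w + (1 - 2 p) w = (1 - p) w. *)
have := le_trans (IH h.+1 ltac:(lia) ltac:(lia)) step.
rewrite exprS mulrCA; lra.
Qed.

Lemma binomial_tail_ge0 p n h : 0 <= p <= 1 -> 0 <= binomial_tail p n h.
Proof.
move=> /andP[p0 p1]; elim: n h => [|n IH] [|h] //=.
by rewrite addr_ge0// mulr_ge0// subr_ge0.
Qed.

(** Squaring turns the Chernoff denominator 3^h into 3^n 3^d, which avoids sqrt 3 and keeps the
    spare factor 3 when n is odd. *)
Lemma binomial_tail_sqr p n h d : 0 <= p <= 1 -> (n + d)%N = h.*2 ->
  binomial_tail p n h ^+ 2 * 3 ^+ d <= ((1 + 2 * p) ^+ 2 / 3) ^+ n.
Proof.
move=> p01 nd; have T0 := binomial_tail_ge0 n h p01.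
have := binomial_tail_chernoff n h p01.
rewrite -ler_sqr ?nnegrE//; last by apply: le_trans T0 _; exact: binomial_tail_chernoff.
rewrite -(@ler_pM2r _ (3 ^+ d)) ?exprn_gt0// => /le_trans; apply.
rewrite !expr_div_n -!exprM [(2 * n)%N]mulnC -mulrA.
rewrite ler_wpM2l ?exprn_ge0//; first lra.
by rewrite muln2 -nd exprD; rewrite invfM -mulrA mulVf ?mulr1 ?expf_neq0.
Qed.

End tail.

Lemma central_binomial_step h : ('C(h.*2.+2, h.+1) <= 4 * 'C(h.*2, h))%N.
Proof.
have := mul_bin_diag h.*2.+2 h; have := mul_bin_down h.*2.+1 h.
by rewrite /=; nia.
Qed.

(** Equality holds at h = 3, where the coefficient is 20, and its quotient by 4^h does not increase
    afterwards. *)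
Lemma central_binomial_le h : (2 < h)%N -> (16 * 'C(h.*2, h) <= 5 * 4 ^ h)%N.
Proof.
elim: h => [//|h IH]; rewrite ltnS leq_eqVlt => /predU1P[<-//|/IH].
by have := central_binomial_step h; rewrite expnS doubleS; lia.
Qed.

(** * Tails at half the number of trials, compared with exp(-n/8) *)

Section tail_bounds.
Context (R : realType).
Implicit Types p : R.

(** From exp(-1/8) >= 7/8 and (7/8)^8 > 1/3. *)
Lemma expR1_le3 : expR 1 <= 3 :> R.
Proof.
have h : 7 / 8 <= expR (- 8^-1) :> R by have := @expR_ge1Dx R (- 8^-1); lra.
have e : expR (- 8^-1) ^+ 8 * expR 1 = 1 :> R.
  by rewrite -expRM_natl -expRD -[RHS]expR0; congr expR; field.
have : 3^-1 <= expR (- 8^-1) ^+ 8 :> R.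
  apply: le_trans (_ : (7 / 8) ^+ 8 <= _); first by rewrite !exprS expr0; lra.
  by rewrite lerXn2r ?nnegrE ?expR_ge0//; lra.
have := expR_gt0 (1 : R); move: e; set a := expR _ ^+ 8; nra.
Qed.

Lemma expRN4_ge : 3 / 4 <= expR (- 4^-1) :> R.
Proof. by have := @expR_ge1Dx R (- 4^-1); lra. Qed.

Lemma expRN8_sqr n : expR (- (n%:R / 8)) ^+ 2 = expR (- 4^-1) ^+ n :> R.
Proof. by rewrite -!expRM_natl; congr expR; field. Qed.

(** For p = 1/4 the base (1 + 2 p)^2 / 3 equals 3/4, which is at most exp(-1/4). *)
Lemma binomial_tail_quarter n h : (n <= h.*2)%N ->
  binomial_tail (4^-1 : R) n h <= expR (- (n%:R / 8)).
Proof.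
move=> nh; have p01 : 0 <= (4^-1 : R) <= 1 by apply/andP; split; lra.
rewrite -ler_sqr ?nnegrE ?expR_ge0 ?binomial_tail_ge0// expRN8_sqr.
have := binomial_tail_sqr p01 (subnKC nh).
have : 1 <= 3 ^+ (h.*2 - n) :> R by rewrite exprn_ege1// ler1n.
have -> : (1 + 2 * 4^-1) ^+ 2 / 3 = 3 / 4 :> R by field.
have : (3 / 4) ^+ n <= expR (- 4^-1) ^+ n :> R.
  by rewrite lerXn2r ?nnegrE ?expR_ge0 ?expRN4_ge//; lra.
have := sqr_ge0 (binomial_tail (4^-1 : R) n h); nra.
Qed.

(* Here (1 + 2 p)^2 / 3 = 3/4 * (1 + u)^2 with u = 1 / (6 h), and the factor
   (1 + u)^(2 (2 h + 1)) <= e is absorbed by the factor 3 of odd sizes. *)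
Lemma binomial_tail_odd h : (0 < h)%N ->
  binomial_tail (h.*2.+1%:R / (4 * h.*2%:R) : R) h.*2.+1 h.+1
    <= expR (- (h.*2.+1%:R / 8)).
Proof.
move=> h0; set p := _ / _; set n := h.*2.+1.
have hR : 1 <= h%:R :> R by rewrite ler1n.
have h20 : h%:R != 0 :> R by lra.
have nE : n%:R = 2 * h%:R + 1 :> R by rewrite /n -addn1 -muln2 natrD natrM mulrC.
have pE : p = 4^-1 * (1 + (2 * h%:R)^-1).
  by rewrite /p nE -muln2 natrM; field.
have u0 : 0 < (2 * h%:R : R)^-1 by rewrite invr_gt0; lra.
have u1 : (2 * h%:R : R)^-1 <= 2^-1 by rewrite lef_pV2 ?posrE; lra.
have p01 : 0 <= p <= 1 by rewrite pE; apply/andP; split; lra.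
rewrite -ler_sqr ?nnegrE ?expR_ge0 ?binomial_tail_ge0// expRN8_sqr.
have nd : (n + 1 = h.+1.*2)%N by rewrite /n; lia.
have := binomial_tail_sqr p01 nd; rewrite expr1.
set u := (6 * h%:R : R)^-1.
have -> : (1 + 2 * p) ^+ 2 / 3 = 3 / 4 * (1 + u) ^+ 2.
  by rewrite pE /u; field.
rewrite exprMn -exprM => T3.
have u_ge0 : 0 <= u by rewrite invr_ge0; lra.
have h1 : (3 / 4) ^+ n <= expR (- 4^-1) ^+ n :> R.
  by rewrite lerXn2r ?nnegrE ?expR_ge0 ?expRN4_ge//; lra.
(* The exponent 2 n u = (2 h + 1) / (3 h) is at most 1. *)
have h2 : (1 + u) ^+ (2 * n) <= 3.
  apply: le_trans expR1_le3; apply: (@le_trans _ _ (expR u ^+ (2 * n))).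
    by rewrite lerXn2r ?nnegrE ?expR_ge0 ?expR_ge1Dx//; lra.
  rewrite -expRM_natl ler_expR natrM nE /u ler_pdivrMr; lra.
have a0 : 0 <= (3 / 4) ^+ n :> R by rewrite exprn_ge0//; lra.
have b0 : 0 <= (1 + u) ^+ (2 * n) by rewrite exprn_ge0//; lra.
have := ler_pM a0 b0 h1 h2; lra.
Qed.

(* For h >= 3 the tail is at most 7/4 * 'C(2h, h) * (p (1 - p))^h with
   'C(2h, h) <= 5/16 * 4^h and (4 p (1 - p))^h <= (3/4)^h * exp (2/5), and
   7/4 * 5/16 * exp (2/5) <= 1. *)
Lemma binomial_tail_even h : (0 < h)%N ->
  binomial_tail (h.*2%:R / (4 * h.*2.-1%:R) : R) h.*2 h
    <= expR (- (h.*2%:R / 8)).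
Proof.
move=> h0; set p := _ / _; set n := h.*2.
(* For h = 1, 2 the tails are 3/4 and 11/27, against exp(-h/4) >= 1 - h/4. At h = 1, p = 1/2 and the
   geometric bound is void. *)
have [h3|h3] := leqP h 2.
  have {h0 h3} [e|e] : h = 1%N \/ h = 2%N by lia.
    have -> : p = 2^-1 by rewrite /p e -[1.*2]/2%N /=; field.
    rewrite /n e -[1.*2]/2%N /=; have := @expR_ge1Dx R (- (2%:R / 8)); lra.
  have -> : p = 3^-1 by rewrite /p e -[2.*2]/4%N /=; field.
  rewrite /n e -[2.*2]/4%N /=; have := @expR_ge1Dx R (- (4%:R / 8)); lra.
have hR : 3 <= h%:R :> R by rewrite (ler_nat _ 3).
have nE : h.*2.-1%:R = 2 * h%:R - 1 :> R.
  by rewrite -subn1 natrB ?double_gt0// -muln2 natrM; ring.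
have n1 : 0 < 2 * h%:R - 1 :> R by lra.
have pE : p = h%:R / (2 * (2 * h%:R - 1)).
  by rewrite /p nE -muln2 natrM; field; lra.
clearbody p.
have qE : 1 - p = (3 * h%:R - 2) / (2 * (2 * h%:R - 1)) by rewrite pE; field; lra.
have rE : 1 - 2 * p = (h%:R - 1) / (2 * h%:R - 1) by rewrite pE; field; lra.
have p0 : 0 <= p by rewrite pE divr_ge0; lra.
have r0 : 0 < 1 - 2 * p by rewrite rE divr_gt0; lra.
have p2 : 0 <= p <= 2^-1 by apply/andP; split; lra.
have := binomial_tail_geometric p2 (leqnn n).
have -> : (n - h = h)%N by rewrite /n; lia.
have -> : 'C(n, h)%:R * p ^+ h * (1 - p) ^+ h.+1 =
    (1 - p) * ('C(n, h)%:R * (p * (1 - p)) ^+ h) by rewrite exprS exprMn; ring.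
move=> T1.
(* The ratio (1 - p) / (1 - 2 p) = (3 h - 2) / (2 (h - 1)) decreases in h and equals 7/4 at h =
   3. *)
have q74 : 1 - p <= 7 / 4 * (1 - 2 * p).
  rewrite qE rE; rewrite mulrA ler_pdivlMr// mulrAC ler_pdivrMr; nra.
set B : R := 'C(n, h)%:R * (p * (1 - p)) ^+ h in T1.
have B0 : 0 <= B by rewrite mulr_ge0// exprn_ge0// mulr_ge0; lra.
have {}T1 : binomial_tail p n h <= 7 / 4 * B.
  by rewrite -(ler_pM2l r0); nra.
apply: le_trans T1 _.
(* 4 p (1 - p) = h (3 h - 2) / (2 h - 1)^2, and 3/4 (1 + v) exceeds this by only 1 / (4 (2 h -
   1)^2). *)
set v : R := 2 / (3 * (2 * h%:R - 1)).
have v0 : 0 <= v by rewrite divr_ge0; lra.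
have pq : p * (1 - p) <= 4^-1 * (3 / 4 * (1 + v)).
  rewrite qE pE mulf_div ler_pdivrMr; last nra.
  have -> : 4^-1 * (3 / 4 * (1 + v)) * (2 * (2 * h%:R - 1) * (2 * (2 * h%:R - 1)))
     = 4^-1 * (2 * h%:R - 1) * (3 * (2 * h%:R - 1) + 2) by rewrite /v; field; lra.
  nra.
have pqh : (p * (1 - p)) ^+ h <= (4 ^+ h)^-1 * (expR (- (n%:R / 8)) * expR (2 / 5)).
  apply: le_trans (_ : (4^-1 * (3 / 4 * (1 + v))) ^+ h <= _).
    by rewrite lerXn2r ?nnegrE//; nra.
  rewrite exprMn exprVn ler_wpM2l ?invr_ge0 ?exprn_ge0// exprMn.
  rewrite ler_pM ?exprn_ge0//; try lra.
    have -> : - (n%:R / 8) = h%:R * - 4^-1 :> R by rewrite /n -muln2 natrM; field.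
    by rewrite expRM_natl lerXn2r ?nnegrE ?expR_ge0 ?expRN4_ge//; lra.
  (* h v <= 2/5 amounts to h >= 3. *)
  apply: (@le_trans _ _ (expR v ^+ h)).
    by rewrite lerXn2r ?nnegrE ?expR_ge0 ?expR_ge1Dx//; lra.
  rewrite -expRM_natl ler_expR /v mulrA ler_pdivrMr; lra.
have Ch : 'C(n, h)%:R * (4 ^+ h)^-1 <= 5 / 16 :> R.
  rewrite ler_pdivrMr ?exprn_gt0//.
  have := central_binomial_le h3; rewrite -(ler_nat R) !natrM natrX; lra.
(* The constants then multiply to 7/4 * 5/16 * 5/3 = 175/192 < 1. *)
have e25 : expR (2 / 5) <= 5 / 3 :> R.
  have e : expR (2 / 5) * expR (- (2 / 5)) = 1 :> R by rewrite -expRD subrr expR0.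
  have := @expR_ge1Dx R (- (2 / 5)); have := expR_gt0 (2 / 5 : R); nra.
have C0 : 0 <= 'C(n, h)%:R :> R by [].
have e0 := expR_gt0 (- (n%:R / 8) : R).
have := ler_wpM2l C0 pqh; rewrite -/B mulrA => B1.
have := ler_wpM2r (ltW e0) Ch; have := expR_gt0 (2 / 5 : R).
have w0 : 0 <= 'C(n, h)%:R * (4 ^+ h)^-1 :> R by rewrite divr_ge0.
move: B1 w0 Ch; set w := _ * _^-1; set E := expR (- _) in e0 *; set F := expR _ in e25 *.
move=> B1 w0 Ch F0 wE.
have := ler_wpM2l (mulr_ge0 w0 (ltW e0)) e25; lra.
Qed.

(** With n blocks and 8 log(1/delta) > n - 1, this p dominates the Chebyshev bound n / (32
    log(1/delta)) of the second claim. *)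
Lemma binomial_tail_corrected n : (1 < n)%N ->
  binomial_tail (n%:R / (4 * n.-1%:R) : R) n (uphalf n) <= expR (- (n%:R / 8)).
Proof.
have [h [->|->]] : exists h, n = h.*2.+1 \/ n = h.*2.
    by exists n./2; have := odd_double_half n; case: odd; lia.
  by rewrite (_ : uphalf _ = h.+1); [move=> ?; apply: binomial_tail_odd|]; lia.
by rewrite (_ : uphalf _ = h); [move=> ?; apply: binomial_tail_even|]; lia.
Qed.

End tail_bounds.

(** * Independence of disjoint blocks *)

(** Measurability is asked on [K] only: for the sigma-algebra of a block, the variables outside it
    need not be measurable. *)
Lemma measurable_sum_in (R : realType) d (T : measurableType d) (I : finType)
    (K : {set I}) (f : I -> T -> R) :
  (forall i, i \in K -> measurable_fun setT (f i)) ->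
  measurable_fun setT (fun w => \sum_(i in K) f i w).
Proof.
move=> mf; rewrite (_ : (fun w => _) =
    (fun w => \sum_(i <- enum K) (if i \in K then f i else cst 0) w)).
  by apply: measurable_sum => i; case: ifPn => iK; [exact: mf|exact: measurable_cst].
by apply/funext => w; rewrite big_enum/=; apply: eq_bigr => i ->.
Qed.

Section independence.
Context (R : realType) d (T : measurableType d) (P : probability T R).

(** Both sides are finite measures in [E] that agree on the pi-system [G], which contains the whole
    space; hence they agree on the sigma-algebra it generates. *)
Lemma independent_g_sigma_algebra (G : set (set T)) (F : set T) :
  G `<=` measurable -> setI_closed G -> G setT -> measurable F ->
  (forall E, G E -> P (E `&` F) = P E * P F)%E ->
  forall E, <<s G >> E -> P (E `&` F) = (P E * P F)%E.
Proof.
move=> Gm GI GT mF GF E sE.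
have PF0 : 0 <= fine (P F) by rewrite fine_ge0.
have PFE : (fine (P F))%:E = P F by rewrite fineK ?fin_num_measure.
have scaleE A : mscale (NngNum PF0) P A = (P A * P F)%E.
  by rewrite /mscale /= fineK ?fin_num_measure// muleC.
rewrite -scaleE; apply: (@g_sigma_algebra_measure_unique _ _ _ G Gm (fun=> setT)
  (fun=> GT) _ (mrestr P mF) (mscale (NngNum PF0) P) GI _ _ E sE).
- by rewrite bigcup_const//; exists 0%N.
- by move=> A GA; rewrite [RHS]scaleE; exact: GF.
- move=> _; rewrite /= /mrestr setTI.
  by rewrite ltey_eq fin_num_measure.
Qed.

Context (n : nat) (X : 'I_n -> {RV P >-> R}).

(** A pi-system generating the sigma-algebra of the [X i] with [i] in [J], on which the product rule
    applies directly. *)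
Definition cylinder (J : {set 'I_n}) : set (set T) :=
  [set E | exists2 A : 'I_n -> set R, (forall i, measurable (A i)) &
     E = \bigcap_(i in [set i | i \in J]) (X i @^-1` A i)].

Lemma measurable_preimage_RV (Y : {RV P >-> R}) (A : set R) : measurable A ->
  measurable (Y @^-1` A).
Proof. by move=> mA; exact: measurable_funPTI. Qed.

Lemma cylinder_measurable J : cylinder J `<=` measurable.
Proof.
move=> _ [A mA ->]; apply: fin_bigcap_measurable; first exact: finite_finset.
by move=> i _; exact: measurable_preimage_RV.
Qed.

Lemma cylinder_setI_closed J : setI_closed (cylinder J).
Proof.
move=> _ _ [A mA ->] [A' mA' ->]; exists (fun i => A i `&` A' i).
  by move=> i; exact: measurableI.
by rewrite -bigcapI.
Qed.

Lemma cylinderT J : cylinder J setT.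
Proof.
exists (fun=> setT) => //; apply/esym; rewrite -subTset => x _ i _.
exact: I.
Qed.

Lemma cylinder_subset (J K : {set 'I_n}) : J \subset K ->
  cylinder J `<=` cylinder K.
Proof.
move=> JK _ [A mA ->]; exists (fun i => if i \in J then A i else setT).
  by move=> i; case: ifP.
apply/seteqP; split => x xA i /= iJ.
  by case: ifPn => // iJ'; exact: xA.
by have := xA i; rewrite /= iJ; apply; exact: (fintype.subsetP JK).
Qed.

Hypothesis indepX : mutually_independent X.

(** Disjointness allows the two families of sets to be glued into one on the union of [J] and [K],
    whose product splits. *)
Lemma cylinder_independent (J K : {set 'I_n}) E F : [disjoint J & K]%B ->
  cylinder J E -> cylinder K F -> P (E `&` F) = (P E * P F)%E.
Proof.
move=> JK [A mA ->] [A' mA' ->].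
pose A'' i := if i \in J then A i else A' i.
have mA'' i : measurable (A'' i) by rewrite /A''; case: ifP.
rewrite [X in P X](_ : _ =
    \bigcap_(i in [set i | i \in (J :|: K)%SET]) (X i @^-1` A'' i)).
  rewrite !indepX// (eq_bigl [predU J & K]); last by move=> i; rewrite !inE.
  rewrite bigU//=; congr (_ * _)%E; apply: eq_bigr => i iJ.
    by rewrite /A'' iJ.
  by rewrite /A'' (disjointFl JK iJ).
apply/seteqP; split => x /=.
  move=> [xA xA'] i /=; rewrite inE /A'' => /orP[iJ|iK].
    by rewrite iJ; exact: xA.
  by rewrite (disjointFl JK iK); exact: xA'.
move=> xA; split => i /= iJ; have := xA i; rewrite /= inE iJ ?orbT /A''.
  by move=> /(_ isT); rewrite iJ.
by move=> /(_ isT); rewrite (disjointFl JK iJ).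
Qed.

Lemma sigma_cylinder_measurable J : <<s cylinder J >> `<=` measurable.
Proof.
by apply: smallest_sub; [exact: sigma_algebra_measurable|exact: cylinder_measurable].
Qed.

Lemma sigma_cylinder_subset (J K : {set 'I_n}) : J \subset K ->
  <<s cylinder J >> `<=` <<s cylinder K >>.
Proof. by move=> JK; apply: sub_sigma_algebra2; exact: cylinder_subset. Qed.

(** Two extensions from cylinders: in [E] for fixed [F], then in [F] for a fixed cylinder. *)
Lemma sigma_cylinder_independent (J K : {set 'I_n}) E F : [disjoint J & K]%B ->
  <<s cylinder J >> E -> <<s cylinder K >> F ->
  P (E `&` F) = (P E * P F)%E.
Proof.
move=> JK sE sF.
apply: (independent_g_sigma_algebra (@cylinder_measurable J)) sE.
- exact: cylinder_setI_closed.
- exact: cylinderT.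
- exact: sigma_cylinder_measurable sF.
move=> E' cE'; rewrite setIC muleC.
apply: (independent_g_sigma_algebra (@cylinder_measurable K)) sF.
- exact: cylinder_setI_closed.
- exact: cylinderT.
- exact: cylinder_measurable cE'.
move=> F' cF'; rewrite setIC muleC.
exact: cylinder_independent JK cE' cF'.
Qed.

Lemma sigma_cylinder_preimage (J : {set 'I_n}) i A : i \in J -> measurable A ->
  <<s cylinder J >> (X i @^-1` A).
Proof.
move=> iJ mA; apply: sub_sigma_algebra.
exists (fun j => if j == i then A else setT); first by move=> j; case: ifP.
apply/seteqP; split=> x /=.
  by move=> Ax j /= _; case: eqP => // ->.
by move=> /(_ i iJ); rewrite /= eqxx.
Qed.

Lemma measurable_fun_sum_sigma_cylinder (J : {set 'I_n}) :
  measurable_fun setT ((fun w => \sum_(i in J) X i w) :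
    g_sigma_algebraType (cylinder J) -> R).
Proof.
apply: (@measurable_sum_in _ _ (g_sigma_algebraType (cylinder J)) _ J) => i iJ.
by move=> _ A mA; rewrite setTI; exact: sigma_cylinder_preimage.
Qed.

Let sigmaC J E : <<s cylinder J >> E -> <<s cylinder J >> (~` E).
Proof. by move=> sE; exact: (@measurableC _ (g_sigma_algebraType (cylinder J))). Qed.

Let sigmaI J E F : <<s cylinder J >> E -> <<s cylinder J >> F ->
  <<s cylinder J >> (E `&` F).
Proof. by move=> sE sF; exact: (@measurableI _ (g_sigma_algebraType (cylinder J))). Qed.

Let sigmaU J E F : <<s cylinder J >> E -> <<s cylinder J >> F ->
  <<s cylinder J >> (E `|` F).
Proof. by move=> sE sF; exact: (@measurableU _ (g_sigma_algebraType (cylinder J))). Qed.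

(** Splits on the first event, as in [binomial_tail]. Measurability with respect to the union of the
    blocks is carried along, since it makes the first event independent of the count over the
    others. *)
Lemma probability_count_le (I : finType) (B : I -> {set 'I_n}) (E : I -> set T)
    (p : R) (s : seq I) (h : nat) :
  (forall j l, j != l -> [disjoint B j & B l]%B) ->
  (forall j, <<s cylinder (B j) >> (E j)) ->
  0 <= p <= 1 -> (forall j, (P (E j) <= p%:E)%E) -> uniq s ->
  <<s cylinder (\big[@finset.setU _/finset.set0]_(j <- s) B j) >>
    [set w | (h <= count (fun j => w \in E j) s)%N] /\
  (P [set w | (h <= count (fun j => w \in E j) s)%N]
    <= (binomial_tail p (size s) h)%:E)%E.
Proof.
move=> Bdisj sE p01 Ep.
elim: s h => [|j s IH] h.
  rewrite big_nil => _; case: h => [|h] /=.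
    rewrite (_ : [set _ | _] = setT); last by apply/seteqP; split.
    by split; [apply: sub_sigma_algebra; exact: cylinderT|exact: probability_le1].
  rewrite (_ : [set _ | _] = set0); last by apply/seteqP; split.
  by split; [exact: sigma_algebra0|rewrite measure0].
move=> /= /andP[js us]; rewrite big_cons; set U := \big[_/_]_(_ <- _) _ in IH *.
have sub1 : B j \subset (B j :|: U)%SET by exact: finset.subsetUl.
have sub2 : U \subset (B j :|: U)%SET by exact: finset.subsetUr.
case: h => [|h].
  rewrite (_ : [set _ | _] = setT); last by apply/seteqP; split.
  split; first by apply: sub_sigma_algebra; exact: cylinderT.
  exact: probability_le1.
have [sN1 PN1] := IH h us; have [sN2 PN2] := IH h.+1 us.
move: sN1 PN1 sN2 PN2; set N1 := [set w | _]; set N2 := [set w | _].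
move=> sN1 PN1 sN2 PN2.
rewrite (_ : [set w | _] = (E j `&` N1) `|` (~` E j `&` N2)); last first.
  apply/seteqP; split => w /=; rewrite /N1 /N2 /=.
    by case: (boolP (w \in E j)); rewrite ?inE ?notin_setE; [left|right].
  by move=> [[wE]|[wE]]; [rewrite mem_set//|rewrite memNset].
split.
  apply: sigmaU; apply: sigmaI; do ?exact: sigma_cylinder_subset sN1;
    do ?exact: sigma_cylinder_subset sN2; do ?apply: sigmaC;
    exact: sigma_cylinder_subset (sE j).
have BU : [disjoint B j & U]%B.
  rewrite /U big_seq; apply: (big_ind (fun V : {set _} => [disjoint B j & V]%B)).
  - by rewrite -setI_eq0 finset.setI0.
  - move=> V W; rewrite -!setI_eq0 finset.setIUr => /eqP-> /eqP->.
    by rewrite finset.setU0.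
  - by move=> l ls; apply: Bdisj; apply: contraNneq js => ->.
have mE : measurable (E j) by exact: sigma_cylinder_measurable (sE j).
have mN1 : measurable N1 by exact: sigma_cylinder_measurable sN1.
have mN2 : measurable N2 by exact: sigma_cylinder_measurable sN2.
have PU : P ((E j `&` N1) `|` (~` E j `&` N2)) =
    (P (E j `&` N1) + P (~` E j `&` N2))%E.
  rewrite measureU//; first exact: measurableI.
    by apply: measurableI => //; exact: measurableC.
  by rewrite setIACA setICr set0I.
rewrite PU.
rewrite (sigma_cylinder_independent BU (sE j) sN1).
rewrite (sigma_cylinder_independent BU (sigmaC (sE j)) sN2).
have PC : P (~` E j) = (1 - fine (P (E j)))%:E.
  by rewrite EFinB fineK ?fin_num_measure//; exact: probability_setC.
rewrite PC.
have N21 : (P N2 <= P N1)%E.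
  by apply: le_measure; rewrite ?inE// => w; rewrite /N1 /N2 /=; exact: ltnW.
have := Ep j; move: N21 PN1 PN2.
have fE A : measurable A -> P A = (fine (P A))%:E.
  by move=> mA; rewrite fineK ?fin_num_measure.
rewrite (fE _ mN1) (fE _ mN2) (fE _ mE) -!EFinM -!EFinD !lee_fin /=.
have [x0 y0] : 0 <= fine (P N1) /\ 0 <= fine (P N2) by rewrite !fine_ge0.
move: (fine (P N1)) (fine (P N2)) (fine (P (E j))) x0 y0 => x y a x0 y0 yx xT yT ap.
have /andP[p0 p1] := p01.
(* Raising a to p adds (p - a) (x - y), and x >= y because [N2] is contained in [N1]. *)
apply: (@le_trans _ _ (p * x + (1 - p) * y)).
  by have := mulr_ge0 (_ : 0 <= p - a) (_ : 0 <= x - y); rewrite !subr_ge0; nra.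
by rewrite lerD// ler_wpM2l// subr_ge0.
Qed.

End independence.

(** * Variance of the block means *)

Section uncorrelated.
Context (R : realType) d (T : measurableType d) (P : probability T R).

Lemma Lfun_measurable (f : T -> R) p : f \in Lfun P p -> measurable_fun setT f.
Proof. by rewrite inE => /andP[]; rewrite inE. Qed.

Lemma Lfun21 (f : T -> R) : f \in Lfun P 2%:E -> f \in Lfun P 1.
Proof. by apply: Lfun_subset12; rewrite fin_num_measure. Qed.

(** The law of the pair agrees with the product of the laws on rectangles, hence everywhere; Fubini
    then factors E[XY]. *)
Lemma independent_covariance0 (X Y : T -> R) :
  X \in Lfun P 2%:E -> Y \in Lfun P 2%:E ->
  (forall A A', measurable A -> measurable A' ->
    P (X @^-1` A `&` Y @^-1` A') = P (X @^-1` A) * P (Y @^-1` A'))%E ->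
  covariance P X Y = 0%E.
Proof.
move=> X2 Y2 XY.
have mX := Lfun_measurable X2; have mY := Lfun_measurable Y2.
have X1 := Lfun21 X2; have Y1 := Lfun21 Y2.
have XY1 := Lfun2_mul_Lfun1 X2 Y2.
rewrite covarianceE//.
pose X' : {RV P >-> R} := mfun_Sub (mem_set mX).
pose Y' : {RV P >-> R} := mfun_Sub (mem_set mY).
have mZ : measurable_fun setT (fun w => (X w, Y w)) by exact: measurable_fun_pair.
pose Z : {mfun T >-> (R * R)%type} := mfun_Sub (mem_set mZ).
pose f (z : (R * R)%type) : \bar R := (z.1 * z.2)%:E.
have mf : measurable_fun setT f.
  by apply/measurable_EFinP; apply: measurable_funM;
    [exact: measurable_fst|exact: measurable_snd].
have ZE A : measurable A ->
  (distribution P X' \x distribution P Y')%E A = distribution P Z A.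
  apply: product_measure_unique => B B' mB mB'.
  exact: XY.
have iXY : P.-integrable setT (f \o Z) by exact/Lfun1_integrable.
have iZ : (distribution P Z).-integrable setT f.
  exact: (@integrable_pushforward _ _ _ _ _ _ mZ P setT f mf iXY measurableT).
have iP : (distribution P X' \x distribution P Y')%E.-integrable setT f.
  apply/integrableP; split => //; move/integrableP : iZ => [_].
  rewrite (@eq_measure_integral _ _ _ _
    (distribution P X' \x distribution P Y')%E)// => A mA _.
  exact/esym/ZE.
have -> : ('E_P[X * Y] = \int[distribution P X']_x \int[distribution P Y']_y f (x, y))%E.
  have := integral12_prod_meas1 iP; rewrite /fubini_F => ->.
  rewrite (@eq_measure_integral _ _ _ _ (distribution P Z)); last first.
    by move=> A mA _; exact: ZE.
  by rewrite unlock (@integral_pushforward _ _ _ _ _ _ mZ P setT f mf iXY measurableT).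
have iY : (distribution P Y').-integrable setT (EFin : R -> \bar R).
  apply: (@integrable_pushforward _ _ _ _ _ _ mY P setT) => //.
    exact/Lfun1_integrable.
have iX : (distribution P X').-integrable setT (EFin : R -> \bar R).
  apply: (@integrable_pushforward _ _ _ _ _ _ mX P setT) => //.
    exact/Lfun1_integrable.
have EY : (\int[distribution P Y']_y y%:E = 'E_P[Y])%E.
  rewrite unlock (@integral_pushforward _ _ _ _ _ _ mY P setT)//.
  exact/Lfun1_integrable.
have EX : (\int[distribution P X']_y y%:E = 'E_P[X])%E.
  rewrite unlock (@integral_pushforward _ _ _ _ _ _ mX P setT)//.
  exact/Lfun1_integrable.
under eq_integral => x _.
  rewrite /f /=; under eq_integral => y _ do rewrite EFinM.
  rewrite integralZl// EY -(fineK (expectation_fin_num Y1)).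
  over.
rewrite integralZr// EX fineK ?expectation_fin_num//.
by rewrite subee// fin_numM// expectation_fin_num.
Qed.

End uncorrelated.

Lemma measurable_pred d (T : measurableType d) (b : T -> bool) :
  measurable_fun setT b -> measurable [set w | b w].
Proof.
move=> mb; have := mb measurableT [set true] I.
by rewrite setTI.
Qed.

(** * Chebyshev's inequality for a strict deviation *)

Section chebyshev.
Context (R : realType) d (T : measurableType d) (P : probability T R).

(* For t > 0 this is Chebyshev's inequality. For t = 0 the variance vanishes
   and the event is a countable union of null sets. *)
Lemma chebyshev_strict (Y : {RV P >-> R}) (mu v t p : R) :
  ('E_P[Y] = mu%:E)%E -> ('V_P[Y] = v%:E)%E -> 0 <= t -> 0 <= p -> v <= p * t ^+ 2 ->
  (P [set w | (t < `|Y w - mu|)%R] <= p%:E)%E.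
Proof.
move=> EY VY t0 p0 vp.
have mY : measurable_fun setT (fun w => `|Y w - mu|).
  by apply: measurableT_comp => //; apply: measurable_funB.
have mge (e : R) : measurable [set w | e <= `|Y w - mu|].
  by apply: measurable_pred; exact: measurable_fun_ler.
have mgt (e : R) : measurable [set w | e < `|Y w - mu|].
  by apply: measurable_pred; exact: measurable_fun_ltr.
have cheb (e : R) : 0 < e -> (P [set w | (e <= `|Y w - mu|)%R] <= (e ^- 2 * v)%:E)%E.
  by move=> e0; have := chebyshev Y e0; rewrite EY VY.
move: t0; rewrite le_eqVlt => /predU1P[t0|t0]; last first.
  apply: (@le_trans _ _ (P [set w | t <= `|Y w - mu|])).
    by apply: le_measure; rewrite ?inE// => w /=; exact: ltW.
  apply: le_trans (cheb _ t0) _.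
  by rewrite lee_fin ler_pdivrMl ?exprn_gt0// mulrC.
have v0 : v = 0.
  apply/eqP; rewrite eq_le; apply/andP; split.
    by move: vp; rewrite -t0 expr0n /= mulr0.
  by rewrite -lee_fin -VY variance_ge0.
suff -> : P [set w | t < `|Y w - mu|] = 0%E by rewrite lee_fin.
apply/eqP; rewrite -measure_le0.
have -> : [set w | t < `|Y w - mu|] = \bigcup_k [set w | k.+1%:R^-1 <= `|Y w - mu|].
  rewrite -t0; apply/seteqP; split => w /=.
    move=> w0; exists (Num.truncn `|Y w - mu|^-1) => //=.
    rewrite invf_ple ?posrE//; apply: ltW.
    by rewrite truncnS_gt.
  by move=> [k _] /=; apply: lt_le_trans; rewrite invr_gt0.
have N : P.-negligible (\bigcup_k [set w | k.+1%:R^-1 <= `|Y w - mu|]).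
  apply: negligible_bigcup => k; apply/negligibleP => //.
  apply/eqP; rewrite -measure_le0; apply: le_trans (cheb _ _) _ => //.
  by rewrite v0 mulr0.
by move: N => /negligibleP ->//; exact: bigcupT_measurable.
Qed.

End chebyshev.

(** * Moments and deviations of a block mean *)

Section block.
Context (R : realType) d (T : measurableType d) (P : probability T R).
Context (n : nat) (X : 'I_n -> {RV P >-> R}) (mu sigma : R).
Hypothesis indepX : mutually_independent X.
Hypothesis X2 : forall i, (X i : T -> R) \in Lfun P 2%:E.
Hypothesis EX : (forall i, 'E_P[X i] = mu%:E)%E.
Hypothesis VX : (forall i, 'V_P[X i] = (sigma ^+ 2)%:E)%E.

Let Sum (s : seq 'I_n) : T -> R := fun w => \sum_(i <- s) X i w.

Let Sum_nil : Sum [::] = cst 0.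
Proof. by apply/funext => w; rewrite /Sum big_nil. Qed.

Let Sum_cons i s : Sum (i :: s) = X i \+ Sum s.
Proof. by apply/funext => w; rewrite /Sum big_cons. Qed.

Let Sum2 s : Sum s \in Lfun P 2%:E.
Proof.
elim: s => [|i s IH]; first by rewrite Sum_nil Lfun_cst.
by rewrite Sum_cons rpredD// lee1n.
Qed.

Lemma covariance_distinct i j : i != j -> covariance P (X i) (X j) = 0%E.
Proof.
move=> ij; apply: independent_covariance0 => // A A' mA mA'.
apply: (@sigma_cylinder_independent _ _ _ _ _ X indepX [set i]%SET [set j]%SET).
- by rewrite disjoints1 inE.
- by apply: sigma_cylinder_preimage mA; rewrite inE.
- by apply: sigma_cylinder_preimage mA'; rewrite inE.
Qed.

Let Sum_cov i s : i \notin s -> covariance P (X i) (Sum s) = 0%E.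
Proof.
elim: s => [|j s IH]; first by rewrite Sum_nil covariance_cst_r.
rewrite inE negb_or => /andP[ij /IH e].
by rewrite Sum_cons covarianceDr// e covariance_distinct// adde0.
Qed.

Let Sum_var s : uniq s -> ('V_P[Sum s] = ((size s)%:R * sigma ^+ 2)%:E)%E.
Proof.
elim: s => [_|i s IH /= /andP[si us]]; first by rewrite Sum_nil variance_cst mul0r.
rewrite Sum_cons varianceD// Sum_cov// mule0 adde0 IH// VX -EFinD.
by congr EFin; rewrite -natr1; ring.
Qed.

Let Sum_exp s : ('E_P[Sum s] = ((size s)%:R * mu)%:E)%E.
Proof.
elim: s => [|i s IH /=]; first by rewrite Sum_nil expectation_cst mul0r.
rewrite Sum_cons expectationD ?Lfun21// EX IH -EFinD.
by congr EFin; rewrite -natr1; ring.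
Qed.

(** The variance is sigma^2 / m, so Chebyshev at sigma sqrt c gives 1 / (m c). A free c serves both
    claims. *)
Lemma block_mean_deviation (m : nat) (K : {set 'I_n}) (c p : R) :
  (0 < m)%N -> #|K| = m -> 0 <= sigma -> 0 < c -> (m%:R * c)^-1 <= p ->
  (P [set w | (sigma * Num.sqrt c < `|m%:R^-1 * \sum_(i in K) X i w - mu|)%R]
    <= p%:E)%E.
Proof.
move=> m0 Km s0 c0 mcp.
have mR : 0 < m%:R :> R by rewrite ltr0n.
pose Z : T -> R := m%:R^-1 \o* Sum (enum K).
have ZE w : Z w = m%:R^-1 * \sum_(i in K) X i w.
  by rewrite /Z /= /Sum big_enum mulrC.
have Z2 : Z \in Lfun P 2%:E by rewrite Lfun_scale// ler1n.
have EZ : ('E_P[Z] = mu%:E)%E.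
  rewrite expectationZl ?Lfun21// Sum_exp -EFinM -cardE Km; congr EFin.
  by rewrite mulrA mulVf ?mul1r// gt_eqF.
have VZ : ('V_P[Z] = (sigma ^+ 2 / m%:R)%:E)%E.
  rewrite varianceZ// Sum_var ?enum_uniq// -EFinM -cardE Km; congr EFin.
  by field; rewrite gt_eqF.
pose Z' : {RV P >-> R} := mfun_Sub (mem_set (Lfun_measurable Z2)).
have -> : [set w | sigma * Num.sqrt c < `|m%:R^-1 * \sum_(i in K) X i w - mu|] =
    [set w | sigma * Num.sqrt c < `|Z' w - mu|].
  by apply/seteqP; split => w /=; rewrite ZE.
have mc0 : 0 < (m%:R * c)^-1 by rewrite invr_gt0 mulr_gt0.
apply: (@chebyshev_strict _ _ _ P Z' mu _ _ p EZ VZ).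
- by rewrite mulr_ge0 ?sqrtr_ge0.
- by rewrite ltW// (lt_le_trans mc0).
rewrite exprMn sqr_sqrtr ?(ltW c0)// mulrCA ler_wpM2l ?sqr_ge0//.
by move: mcp; rewrite invfM ler_pdivrMr.
Qed.

End block.

(** * The median *)

Section median.
Context (R : realType) (k : nat).
Implicit Types x : 'I_k -> R.

Lemma half_le_card (c : nat) : (k%:R / 2 <= c%:R :> R) = (k <= c.*2)%N.
Proof. by rewrite ler_pdivrMr// -natrM ler_nat muln2. Qed.

(* The witness is the smallest x i with at least half of the entries below it. *)
Lemma median_index_exists x : (0 < k)%N -> exists i, is_median_index x i.
Proof.
move=> k0; pose i0 := Ordinal k0.
pose low i := [set j | x j <= x i]%SET.
pose Q i := (k <= #|low i|.*2)%N.
have arith (a b : nat) : (a + b = k -> ~~ (k <= b.*2) -> k <= a.*2)%N by lia.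
have cardC (A : {set 'I_k}) : (#|A| + #|~: A|%SET = k)%N.
  by rewrite cardsC card_ord.
have [M QM] : exists i, Q i.
  exists [arg max_(i > i0) x i]%O; case: arg_maxP => //= i _ imax.
  rewrite /Q (_ : low i = [set: 'I_k]%SET) ?cardsT ?card_ord -?addnn ?leq_addr//.
  by apply/setP => j; rewrite !inE; exact: imax.
pose i := [arg min_(i < M | Q i) x i]%O; exists i.
rewrite {}/i; case: arg_minP => //= i Qi imin.
rewrite /is_median_index !half_le_card; apply/andP; split; first exact: Qi.
have := cardC [set j | x i <= x j]%SET.
have -> : (~: [set j | x i <= x j] = [set j | x j < x i])%SET.
  by apply/setP => j; rewrite !inE -ltNge.
have [/existsP[j0 j0i]|] := boolP [exists j, x j < x i]; last first.
  rewrite negb_exists => /forallP ge.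
  rewrite (_ : [set j | x j < x i]%SET = finset.set0) ?cards0.
    by rewrite addn0 => hc; rewrite -addnn -{1}hc leq_addr.
  by apply/setP => j; rewrite !inE (negbTE (ge j)).
(* The entries below [x i] are those at most [x j], the largest of them; by minimality of [x i] they
   are fewer than half. *)
pose j := [arg max_(j > j0 | x j < x i) x j]%O.
have [ji jmax] : x j < x i /\ forall l, x l < x i -> x l <= x j.
  by rewrite /j; case: arg_maxP.
have -> : [set l | x l < x i]%SET = low j.
  apply/setP => l; rewrite !inE; apply/idP/idP; first exact: jmax.
  by move=> /le_lt_trans; apply.
have : ~~ Q j by apply: contraTN ji => /imin; rewrite -leNgt.
by move=> nQ hc; exact: arith hc nQ.
Qed.

(** If the median lies above mu + t, so do all entries at least as large, which are half of them;
    symmetrically below mu - t. *)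
Lemma median_deviation x (mu t : R) : (0 < k)%N -> t < `|median x - mu| ->
  (uphalf k <= #|[set j | (t < `|x j - mu|)%R]%SET|)%N.
Proof.
move=> k0; rewrite /median; case: pickP => [i /andP[+ _]|none]; last first.
  have [i0 Mi0] := median_index_exists x k0.
  pose i := [arg min_(i < i0 | is_median_index x i) (i : nat)].
  have [Mi imin] : is_median_index x i /\
      forall j, is_median_index x j -> (i <= j)%N.
    by rewrite /i; case: arg_minnP.
  have := none i; rewrite Mi /= => /negbT; rewrite negb_forall => /existsP[j].
  by rewrite negb_imply => /andP[/imin ->].
rewrite /is_median_index !half_le_card => /andP[lo hi].
have arith (a b : nat) : (k <= a.*2 -> a <= b -> uphalf k <= b)%N by lia.
have sub (A : {set 'I_k}) : (k <= #|A|.*2)%N ->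
    A \subset [set j | t < `|x j - mu|]%SET ->
    (uphalf k <= #|[set j | (t < `|x j - mu|)%R]%SET|)%N.
  by move=> kA /subset_leq_card; exact: arith.
rewrite lter_normr => /orP[h|h].
  apply: sub hi _; apply/fintype.subsetP => j; rewrite !inE => ij.
  by rewrite lter_normr; apply/orP; left; lra.
apply: sub lo _; apply/fintype.subsetP => j; rewrite !inE => ij.
by rewrite lter_normr; apply/orP; right; lra.
Qed.

End median.

(** A finite union, over the truth patterns accepted by [G], of finite intersections. *)
Lemma measurable_finite_pred d (T : measurableType d) (I : finType)
    (b : I -> T -> bool) (G : {ffun I -> bool} -> bool) :
  (forall i, measurable_fun setT (b i)) ->
  measurable [set w | G [ffun i => b i w]].
Proof.
move=> mb.
rewrite (_ : [set w | _] = \bigcup_(f in [set f | G f])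
    \bigcap_(i in [set: I]) [set w | b i w == f i]).
  apply: fin_bigcup_measurable => [|f _]; first exact: finite_finset.
  apply: fin_bigcap_measurable => [|i _]; first exact: finite_finset.
  apply: measurable_pred; case: (f i).
    by rewrite (_ : (fun w => _) = b i)//; apply/funext => w; rewrite eqb_id.
  rewrite (_ : (fun w => _) = (fun w => ~~ b i w)); first exact: measurable_neg.
  by apply/funext => w; rewrite eqbF_neg.
apply/seteqP; split => w /=.
  by move=> Gw; exists [ffun i => b i w] => // i _ /=; rewrite ffunE.
move=> [f Gf fw]; rewrite (_ : [ffun i => b i w] = f)//.
by apply/ffunP => i; rewrite ffunE; exact/eqP/fw.
Qed.

(** The selected index depends only on comparisons between entries, so finitely many Booleans decide
    the event. *)
Lemma measurable_median_deviation (R : realType) d (T : measurableType d)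
    (k : nat) (Z : 'I_k -> T -> R) (mu t : R) :
  (forall j, measurable_fun setT (Z j)) ->
  measurable [set w | t < `|median (fun j => Z j w) - mu|].
Proof.
move=> mZ.
pose b (u : 'I_k * 'I_k + 'I_k) w := match u with
  | inl u => Z u.1 w <= Z u.2 w
  | inr i => t < `|Z i w - mu|
  end.
have mb u : measurable_fun setT (b u).
  case: u => [u|i]; first exact: measurable_fun_ler.
  apply: measurable_fun_ltr => //; apply: measurableT_comp => //.
  exact: measurable_funB.
pose M (f : {ffun 'I_k * 'I_k + 'I_k -> bool}) i :=
  (k%:R / 2 <= #|[set j | f (inl (j, i))]%SET|%:R :> R) &&
  (k%:R / 2 <= #|[set j | f (inl (i, j))]%SET|%:R :> R).
(* The last branch mirrors the default value 0 of [median]. *)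
pose G f := if [pick i | M f i && [forall j, M f j ==> (i <= j)%N]]
  is Some i then f (inr i) else (t < `|0 - mu|).
rewrite (_ : [set w | _] = [set w | G [ffun u => b u w]]).
  exact: measurable_finite_pred.
have ME w i : is_median_index (fun j => Z j w) i = M [ffun u => b u w] i.
  rewrite /is_median_index /M; congr (_ && _); congr (_ <= _%:R);
    by apply: eq_card => j; rewrite !inE ffunE.
apply/funext => w; rewrite /= /median /G.
rewrite (eq_pick (Q := fun i => M [ffun u => b u w] i &&
  [forall j, M [ffun u => b u w] j ==> (i <= j)%N])); last first.
  move=> i /=; rewrite ME; congr (_ && _).
  by apply: eq_forallb => j; rewrite ME.
by case: pickP => // i _; rewrite ffunE.
Qed.

(** * The tail of the median of means *)

Section tail.
Context (R : realType) (d : measure_display)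
    (T : measurableType d) (P : probability T R) (n m k : nat)
    (X : 'I_n -> {RV P >-> R}) (mu sigma : R) (B : 'I_k -> {set 'I_n}).
Hypotheses (m0 : (0 < m)%N) (k0 : (0 < k)%N).
Hypothesis indepX : mutually_independent X.
Hypothesis X2 : forall i, (X i : T -> R) \in Lfun P 2%:E.
Hypothesis EX : (forall i, 'E_P[X i] = mu%:E)%E.
Hypothesis sigma0 : 0 <= sigma.
Hypothesis VX : (forall i, 'V_P[X i] = (sigma ^+ 2)%:E)%E.
Hypothesis blocksB : blocks m B.

Let Z := block_mean m B (fun i => X i : T -> R).

Lemma measurable_median_of_means_deviation (t : R) :
  measurable [set w | t < `|median_of_means m B (fun i => X i : T -> R) w - mu|].
Proof.
apply: (@measurable_median_deviation _ _ _ _ Z) => j.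
by apply: measurable_funM => //; exact: measurable_sum_in.
Qed.

Lemma sigma_cylinder_block_mean j (t : R) :
  <<s cylinder X (B j) >> [set w | t < `|Z j w - mu|].
Proof.
apply: (@measurable_pred _ (g_sigma_algebraType (cylinder X (B j)))
  (fun w => t < `|Z j w - mu|)).
apply: measurable_fun_ltr => //; apply: measurableT_comp => //.
apply: measurable_funB => //; apply: measurable_funM => //.
exact: measurable_fun_sum_sigma_cylinder.
Qed.

(** Common to both claims: c = 4 / m with p = 1/4, then c = 32 log(1/delta) / n. *)
Lemma median_of_means_tail (c p : R) : 0 < c -> (m%:R * c)^-1 <= p -> p <= 1 ->
  (P [set w | (sigma * Num.sqrt c <
        `|median_of_means m B (fun i => X i : T -> R) w - mu|)%R]
    <= (binomial_tail p k (uphalf k))%:E)%E.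
Proof.
move=> c0 mcp p1; have [Bm Bdisj _] := blocksB.
set t := sigma * _.
pose E j := [set w | t < `|Z j w - mu|].
have p01 : 0 <= p <= 1.
  by rewrite p1 andbT (le_trans _ mcp)// invr_ge0 mulr_ge0// ltW.
have BD j l : j != l -> [disjoint B j & B l]%B.
  by move=> /Bdisj jl; rewrite -setI_eq0; exact/eqP.
have EP j : (P (E j) <= p%:E)%E by exact: block_mean_deviation.
have sE j : <<s cylinder X (B j) >> (E j) by exact: sigma_cylinder_block_mean.
have [sC PC] := probability_count_le indepX (uphalf k) BD sE p01 EP (enum_uniq 'I_k).
rewrite size_enum_ord in PC; apply: le_trans PC.
apply: le_measure; rewrite ?inE.
- exact: measurable_median_of_means_deviation.
- exact: sigma_cylinder_measurable sC.
move=> w /= /(median_deviation k0) kE; apply: leq_trans kE _.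
rewrite cardE -size_filter /enum_mem -filter_predI; apply: eq_leq.
congr size; apply: eq_filter => j /=; rewrite !inE andbT.
by apply/idP/idP; rewrite inE.
Qed.

End tail.

(* The alternative (1 < k \/ 1 <= 32 delta log(1/delta)) leaves out only the
   delta extremely close to 1 (k = 1 and delta > 0.9682...) for which the last
   bound is false: e.g. n = m = k = 1, X = +1 or -1 with probability 1/2 and
   32 log(1/delta) < 1. *)
Theorem theorem2 (R : realType) (d : measure_display) (T : measurableType d)
    (P : probability T R) (n m k : nat) (X : 'I_n -> {RV P >-> R})
    (mu sigma : R) (B : 'I_k -> {set 'I_n}) :
  (0 < m)%N -> (0 < k)%N -> n = (m * k)%N ->
  mutually_independent X ->
  identically_distributed X ->
  (forall i, (X i : T -> R) \in Lfun P 2%:E) ->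
  (forall i, 'E_P[X i] = mu%:E)%E ->
  0 <= sigma ->
  (forall i, 'V_P[X i] = (sigma ^+ 2)%:E)%E ->
  blocks m B ->
  (P [set w | (`|median_of_means m B (fun i => X i : T -> R) w - mu|
                 > sigma * Num.sqrt (4 / m%:R))%R]
     <= (expR (- (k%:R / 8)))%:E)%E
  /\
  (forall delta : R, 0 < delta -> delta < 1 ->
     k%:Z = Num.ceil (8 * ln (1 / delta)) ->
     (1 < k)%N \/ 1 <= 32 * delta * ln (1 / delta) ->
     (P [set w | (`|median_of_means m B (fun i => X i : T -> R) w - mu|
                    <= sigma * Num.sqrt (32 * ln (1 / delta) / n%:R))%R]
        >= (1 - delta)%:E)%E).
Proof.
move=> m0 k0 nmk indepX _ X2 EX sigma0 VX blocksB.
have mR : 0 < m%:R :> R by rewrite ltr0n.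
have kR : 0 < k%:R :> R by rewrite ltr0n.
have tail := median_of_means_tail m0 k0 indepX X2 EX sigma0 VX blocksB.
split.
  have := tail (4 / m%:R) 4^-1; rewrite divr_gt0// mulrCA mulfV ?gt_eqF// mulr1.
  move=> /(_ isT (lexx _)) tail4; apply: le_trans (tail4 _) _; first lra.
  by rewrite lee_fin binomial_tail_quarter//; lia.
move=> delta delta0 delta1 kceil small.
set L := ln (1 / delta) in kceil small *.
have LE : delta = expR (- L).
  by rewrite /L div1r lnV ?posrE// opprK lnK.
have L0 : 0 < L by rewrite ln_gt0// div1r invf_gt1.
set c := 32 * L / n%:R.
have nR : n%:R = m%:R * k%:R :> R by rewrite nmk natrM.
have c0 : 0 < c by rewrite divr_gt0 ?mulr_gt0// nR mulr_gt0.
have mc : (m%:R * c)^-1 = k%:R / (32 * L).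
  by rewrite /c nR; field; rewrite !gt_eqF.
have kL : k%:R - 1 < 8 * L <= k%:R.
  have := ceil_itv (8 * L); rewrite -kceil.
  by rewrite intrB.
have [kL1 kL2] := andP kL.
have expdelta : expR (- (k%:R / 8)) <= delta.
  by rewrite LE ler_expR; lra.
suff tail_delta : (P [set w | (sigma * Num.sqrt c <
    `|median_of_means m B (fun i => X i : T -> R) w - mu|)%R] <= delta%:E)%E.
  have mtail := measurable_median_of_means_deviation m X mu B (sigma * Num.sqrt c).
  rewrite [X in (_ <= P X)%E](_ : _ = ~` [set w | sigma * Num.sqrt c <
    `|median_of_means m B (fun i => X i : T -> R) w - mu|]); last first.
    by apply/seteqP; split => w /=; rewrite leNgt => /negP.
  have := probability_setC P mtail; set A := [set w | _] => PC.
  rewrite PC EFinB; exact: leeB.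
have [k2|k1] := ltnP 1 k.
  have k1R : 1 < k%:R :> R by rewrite ltr1n.
  have k'R : k.-1%:R = k%:R - 1 :> R by rewrite -subn1 natrB.
  (* k / (32 L) <= k / (4 (k - 1)), from 8 L > k - 1. *)
  apply: le_trans (tail c (k%:R / (4 * k.-1%:R)) c0 _ _) _.
  - rewrite mc ler_wpM2l// lef_pV2 ?posrE; rewrite ?k'R; lra.
  - have k2R : 2 <= k%:R :> R by rewrite ler_nat.
    rewrite k'R ler_pdivrMr; lra.
  by rewrite lee_fin; apply: le_trans expdelta; exact: binomial_tail_corrected.
have kE : k = 1%N by lia.
have {}small : 1 <= 32 * delta * L by case: small => //; lia.
(* For k = 1 the tail is p itself, and 1 / (32 L) <= delta allows p = delta. *)
apply: le_trans (tail c delta c0 _ (ltW delta1)) _.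
  by rewrite mc kE ler_pdivrMr ?mulr_gt0// mulrCA mulrA.
by rewrite lee_fin kE /= !mulr1 mulr0 addr0.
Qed.
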